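(* Suppose $f:\mathbb R^d\to\mathbb R$ is typical at $\bar x\in\mathbb R^d$ (see context, where $\mathcal M$ and the constants $\gamma,\mu,L,\beta,D_1,C_2,\delta_{\mathrm{GI}}$ are defined). For any constants $a_1\in(0,D_1]$ and $a_2\in(0,C_2]$ we have $$\sigma\operatorname{dist}(0,\partial_\sigma f(x))\ \ge\ \min\left\{\frac{\gamma a_2}{8\max\{4La_2^2,\beta\}},\ \frac{\mu a_1}{4\max\{2L,\beta/a_2^2\}}\right\}(f(x)-f(\bar x))$$ whenever $x\in B_{\delta_{\mathrm{GI}}}(\bar x)$ and $\sigma>0$ satisfy at least one of the following: 1. (a) $\frac{a_1}{2}\operatorname{dist}(x,\mathcal M)\le\sigma\le a_1\operatorname{dist}(x,\mathcal M)$ and (b) $a_2^2\|P_{\mathcal M}(x)-\bar x\|^2\le\operatorname{dist}(x,\mathcal M)$; 2. (a) $\frac{a_2}{2}\|P_{\mathcal M}(x)-\bar x\|\le\sigma\le a_2\|P_{\mathcal M}(x)-\bar x\|$ and (b) $\frac{\operatorname{dist}(x,\mathcal M)}{\sigma}\le 2a_2\|P_{\mathcal M}(x)-\bar x\|$. Moreover, for any $x\in B_{\delta_{\mathrm{GI}}}(\bar x)\setminus\{\bar x\}$ there exists $\sigma>0$ such that item 1 or item 2 is satisfied.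
   Context: Notation: $\|\cdot\|$ is the Euclidean norm; $B_r(x),\overline B_r(x)$ are open and closed balls; $\operatorname{dist}(x,X)=\inf_{y\in X}\|x-y\|$; $P_X$ is the (nearest-point/orthogonal) projection onto $X$. For locally Lipschitz $f$, $\partial f(x)$ is the Clarke subdifferential: the convex hull of all limits $\lim_i\nabla f(x_i)$ with $x_i\to x$ and $f$ differentiable at each $x_i$. Goldstein subdifferential: $\partial_\sigma f(x)=\operatorname{conv}\bigcup_{y\in\overline B_\sigma(x)}\partial f(y)$. Manifolds: $\mathcal M$ is a $C^p$ manifold around $\bar x$ if $\mathcal M\cap U=F^{-1}(0)$ for an open neighborhood $U$ of $\bar x$ and a $C^p$ map $F:U\to\mathbb R^m$ with surjective Jacobian; $T_{\mathcal M}(x)=\ker\nabla F(x)$, $N_{\mathcal M}(x)=T_{\mathcal M}(x)^\perp$. A function is $C^q$ on $\mathcal M$ near a point if it agrees on $\mathcal M$ near that point with a $C^q$ function $\hat f$ defined on an open set; the covariant gradient is $\nabla_{\mathcal M}f(x)=P_{T_{\mathcal M}(x)}(\nabla\hat f(x))$ (independent of $\hat f$). Let $0\in\partial f(\bar x)$ and $\bar x\in\mathcal M$. $\mathcal M$ is an active $C^p$ manifold for $f$ around $\bar x$ if $\mathcal M$ is a $C^p$ manifold around $\bar x$, $f|_{\mathcal M}$ is $C^p$ near $\bar x$, and $\inf\{\|v\|:v\in\partial f(x),x\in U\setminus\mathcal M\}>0$ for some neighborhood $U$ of $\bar x$. ''$f$ is typical at $\bar x$'' means: $f$ is locally Lipschitz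 with local minimizer $\bar x$, and (A1) there is $\gamma>0$ with $f(x)-f(\bar x)\ge\frac\gamma2\|x-\bar x\|^2$ for all $x$ near $\bar x$; (A2) $f$ admits a $C^4$ active manifold $\mathcal M$ around $\bar x$; (A3) there is $C_{(a)}>0$ with $\|P_{T_{\mathcal M}(y)}(v-\nabla_{\mathcal M}f(y))\|\le C_{(a)}\|x-y\|$ for all $x\in\mathbb R^d$, $v\in\partial f(x)$, $y\in\mathcal M$ near $\bar x$; (A4) $f(y)\ge f(x)+\langle v,y-x\rangle+o(\|y-x\|)$ as $y\to\bar x$ within $\mathcal M$ and $x\to\bar x$ with $v\in\partial f(x)$, where $o(\cdot)$ is a univariate function with $\lim_{t\to0}o(t)/t=0$. Constants: $\gamma,C_{(a)},\mathcal M$ are as in (A1)–(A4). For a map $F$, $\operatorname{lip}_F(\bar x)=\limsup_{x,x'\to\bar x,\,x\ne x'}\|F(x)-F(x')\|/\|x-x'\|$; $\operatorname{lip}^{\mathrm{op}}_F$ is the same for matrix-valued $F$ with the operator norm in the numerator. Put $f_{\mathcal M}=f\circ P_{\mathcal M}$, $C_{\mathcal M}=2\operatorname{lip}^{\mathrm{op}}_{\nabla P_{\mathcal M}}(\bar x)$, $\beta=2\operatorname{lip}_{\nabla f_{\mathcal M}}(\bar x)$, $L=2\operatorname{lip}_f(\bar x)$, $\mu=\frac14\liminf_{x'\to\bar x,\,x'\notin\mathcal M}\operatorname{dist}(0,\partial f(x'))$. Fix $\delta_A>0$ (such a radius exists) such that on $B_{2\delta_A}(\bar x)$ the map $P_{\mathcal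 M}$ is $C^3$ with Lipschitz Jacobian and $f_{\mathcal M}$ is $C^3$ with Lipschitz gradient, and, writing $y=P_{\mathcal M}(x)$: (1) $f(x)-f(\bar x)\ge\frac\gamma2\|x-\bar x\|^2$ on $\overline B_{2\delta_A}(\bar x)$; (2) $\|P_{\mathcal M}(x')-y-P_{T_{\mathcal M}(y)}(x'-x)\|\le C_{\mathcal M}(\operatorname{dist}^2(x,\mathcal M)+\|x-x'\|^2)$ for $x\in B_{\delta_A}(\bar x)$, $x'\in B_{2\delta_A}(\bar x)$; and for all $x\in B_{\delta_A}(\bar x)$ and $0<\sigma\le\delta_A$: (3) $\frac\gamma2\|y-\bar x\|\le\|\nabla_{\mathcal M}f(y)\|\le\beta\|y-\bar x\|$; (4) for all $g,g'\in\partial_\sigma f(x)$: $\|P_{T_{\mathcal M}(y)}(g-\nabla_{\mathcal M}f(y))\|\le C_{(a)}(\operatorname{dist}(x,\mathcal M)+\sigma)$, $\|P_{T_{\mathcal M}(y)}g\|\le C_{(a)}(\operatorname{dist}(x,\mathcal M)+\sigma)+\beta\|y-\bar x\|$, $\|P_{T_{\mathcal M}(y)}(g-g')\|\le2C_{(a)}(\operatorname{dist}(x,\mathcal M)+\sigma)$; (5) $\langle v,x-y\rangle\ge\mu\operatorname{dist}(x,\mathcal M)$ for all $v\in\partial f(x)$; (6) $\|g\|\le L$ for all $g\in\partial_\sigma f(x)$; (7) $f(x)-f(\bar x)\le L\operatorname{dist}(x,\mathcal M)+\frac\beta2\|y-\bar x\|^2$. Finally $D_1=\frac{\mu}{8(\mu+L)}$,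 $C_2=\min\{\frac{\gamma}{8C_{(a)}},\frac{\min\{1,1/\delta_A\}}{2}\}$, $\delta_{\mathrm{GI}}=\min\{\frac{\delta_A}{4},\frac{D_1}{C_{\mathcal M}}\}$. *)

(* Defs.v *)
From HB Require Import structures.
From mathcomp Require Import all_boot all_order all_algebra.
From mathcomp Require Import all_classical all_reals all_analysis.

Set Implicit Arguments.
Unset Strict Implicit.
Unset Printing Implicit Defensive.

Import Order.TTheory GRing.Theory Num.Theory.
Import numFieldNormedType.Exports.

Local Open Scope classical_set_scope.
Local Open Scope ring_scope.

(* The library norm `|x| on 'rV[R]_d is the sup norm. It gives the usual
   topology of R^d, hence the right notions of neighbourhood, limit and
   differentiability; every quantitative estimate below uses enorm instead. *)
Section Euclidean.
Context {R : realType} {d : nat}.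
Implicit Types (x y : 'rV[R]_d) (X : set 'rV[R]_d).

Definition dotp x y : R := \sum_(i < d) x 0 i * y 0 i.

Definition enorm x : R := Num.sqrt (dotp x x).

Definition eball x (r : R) : set 'rV[R]_d := [set y | enorm (y - x) < r].

Definition ecball x (r : R) : set 'rV[R]_d := [set y | enorm (y - x) <= r].

(* +oo for X = set0 *)
Definition edist_set x X : \bar R := ereal_inf [set (enorm (x - y))%:E | y in X].

(* only used for nonempty X *)
Definition dist_set x X : R := fine (edist_set x X).

Definition nearest X x y : Prop :=
  X y /\ forall z, X z -> enorm (x - y) <= enorm (x - z).

Definition projset X x : 'rV[R]_d := xget 0 (nearest X x).

Definition convhull X : set 'rV[R]_d :=
  [set x | exists n (c : 'I_n -> R) (g : 'I_n -> 'rV[R]_d),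
    [/\ forall i, 0 <= c i, \sum_(i < n) c i = 1, forall i, X (g i)
      & x = \sum_(i < n) c i *: g i]].

End Euclidean.

(* Vectors are rows and 'd F x v = v *m 'J F x, so 'J F x is the transpose of
   the usual Jacobian; it has the same operator norm. *)
Definition opnorm {R : realType} {d m : nat} (A : 'M[R]_(d, m)) : R :=
  sup [set enorm (v *m A) | v in [set v | enorm v <= 1]].

Definition grad {R : realType} {d : nat} (f : 'rV[R]_d -> R) (x : 'rV[R]_d) :
  'rV[R]_d := \row_i 'D_(delta_mx 0 i) f x.

(* f is C^k on the open set D. In finite dimension x |-> 'd f x is C^k as an
   operator-valued map iff all x |-> 'd f x v, v fixed, are C^k. *)
Fixpoint Ck {R : realType} {V W : normedModType R} (k : nat) (D : set V)
    (f : V -> W) : Prop :=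
  match k with
  | 0%N => forall x, D x -> {for x, continuous f}
  | k'.+1 => (forall x, D x -> differentiable f x) /\
             forall v, Ck k' D (fun x => 'D_v f x)
  end.

Section Lipschitz.
Context {R : realType} {d : nat} {W : zmodType}.
Implicit Types (nrm : W -> R) (F : 'rV[R]_d -> W).

Definition lipschitz_in nrm (D : set 'rV[R]_d) F : Prop :=
  exists K : R, forall x x', D x -> D x' ->
    nrm (F x - F x') <= K * enorm (x - x').

(* fine turns infinite values into 0; the limsup is infinite only if F is not
   Lipschitz near xbar, or (value -oo) if d = 0, when no pair x <> x' exists. *)
Definition lip nrm F (xbar : 'rV[R]_d) : R :=
  fine (limf_esup
    (fun p : 'rV[R]_d * 'rV[R]_d =>
       (nrm (F p.1 - F p.2) / enorm (p.1 - p.2))%:E)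
    (within [set p | p.1 != p.2] (nbhs (xbar, xbar)))).

End Lipschitz.

Section Nonsmooth.
Context {R : realType} {d : nat}.
Local Notation E := 'rV[R]_d.
Implicit Types (f : E -> R) (M : set E) (x xbar y : E).

Definition locally_lipschitz f : Prop :=
  forall x, exists2 D, nbhs x D & lipschitz_in (@Num.norm R R) D f.

Definition clarke f x : set E :=
  convhull [set v | exists u : nat -> E,
    [/\ u @ \oo --> x, forall i, differentiable f (u i)
      & (fun i => grad f (u i)) @ \oo --> v]].

Definition goldstein f (sigma : R) x : set E :=
  convhull (\bigcup_(y in ecball x sigma) clarke f y).

Definition defining_map (p : nat) M x (m : nat) (U : set E)
    (F : E -> 'rV[R]_m) : Prop :=
  [/\ open U, U x, Ck p U F, forall z, U z -> row_full ('J F z)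
    & M `&` U = [set z | U z /\ F z = 0]].

Definition manifold (p : nat) M x : Prop :=
  exists m U (F : E -> 'rV[R]_m), defining_map p M x U F.

(* The kernel is the same for all defining maps around x, so the choice made
   by xget is immaterial. The default value is only taken where M is not a
   manifold. *)
Definition tangent M x : set E :=
  xget [set 0] [set T | exists m U (F : E -> 'rV[R]_m),
    defining_map 1 M x U F /\ T = [set v | v *m 'J F x = 0]].

Definition smooth_extension (q : nat) M f y (fhat : E -> R) : Prop :=
  exists V : set E,
    [/\ open V, V y, Ck q V fhat & forall z, M z -> V z -> fhat z = f z].

Definition smooth_on (q : nat) M f y : Prop :=
  exists fhat, smooth_extension q M f y fhat.

(* independent of the chosen extension, as for tangent *)
Definition cov_grad M f y : E :=
  xget 0 [set w | exists fhat,
    smooth_extension 1 M f y fhat /\ w = projset (tangent M y) (grad fhat y)].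

Definition active_manifold (p : nat) M f xbar : Prop :=
  [/\ clarke f xbar 0, M xbar, manifold p M xbar, smooth_on p M f xbar
    & exists2 U, nbhs xbar U &
        (0 < ereal_inf [set (enorm v)%:E | v in
               \bigcup_(x in U `\` M) clarke f x])%E].

Record typical f xbar M (gamma Ca : R) : Prop := Typical {
  typical_lip : locally_lipschitz f;
  typical_min : \forall x \near xbar, f xbar <= f x;
  typical_gamma_gt0 : 0 < gamma;
  typical_growth : \forall x \near xbar,
    gamma / 2 * enorm (x - xbar) ^+ 2 <= f x - f xbar;
  typical_active : active_manifold 4 M f xbar;
  typical_Ca_gt0 : 0 < Ca;
  typical_strong_a : \forall x \near xbar & y \near xbar,
    forall v, clarke f x v -> M y ->
    enorm (projset (tangent M y) (v - cov_grad M f y)) <= Ca * enorm (x - y);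
  typical_b_le : exists o : R -> R,
    (fun t => o t / t) @ (0 : R)^' --> (0 : R) /\
    \forall x \near xbar & y \near xbar,
      forall v, clarke f x v -> M y ->
      f x + dotp v (y - x) + o (enorm (y - x)) <= f y
}.

Definition C_M M xbar : R := 2 * lip opnorm (fun x => 'J (projset M) x) xbar.

Definition betaC f M xbar : R := 2 * lip enorm (grad (f \o projset M)) xbar.

Definition LC f xbar : R := 2 * lip (@Num.norm R R) f xbar.

(* The liminf is +oo (and muC is then 0) only if M is a neighbourhood of xbar.
   In that case f is C^4 near its minimizer xbar, so LC f xbar = 0 and
   admissible_radius below holds for no radius unless d = 0. *)
Definition muC f M xbar : R :=
  4^-1 * fine (limf_einf (fun x => edist_set 0 (clarke f x))
                         (within (~` M) (nbhs xbar))).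

Record admissible_radius f xbar M (gamma Ca deltaA : R) : Prop :=
    AdmissibleRadius {
  ar_gt0 : 0 < deltaA;
  ar_proj : forall x, eball xbar (2 * deltaA) x -> exists! y, nearest M x y;
  ar_proj_C3 : Ck 3 (eball xbar (2 * deltaA)) (projset M);
  ar_proj_lip : lipschitz_in opnorm (eball xbar (2 * deltaA))
                  (fun x => 'J (projset M) x);
  ar_fM_C3 : Ck 3 (eball xbar (2 * deltaA)) (f \o projset M);
  ar_fM_lip : lipschitz_in enorm (eball xbar (2 * deltaA))
                (grad (f \o projset M));
  ar_growth : forall x, ecball xbar (2 * deltaA) x ->
    gamma / 2 * enorm (x - xbar) ^+ 2 <= f x - f xbar;
  ar_proj_taylor : forall x x', eball xbar deltaA x ->
    eball xbar (2 * deltaA) x' ->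
    let y := projset M x in
    enorm (projset M x' - y - projset (tangent M y) (x' - x))
      <= C_M M xbar * (dist_set x M ^+ 2 + enorm (x - x') ^+ 2);
  ar_cov_grad : forall x, eball xbar deltaA x ->
    let y := projset M x in
    gamma / 2 * enorm (y - xbar) <= enorm (cov_grad M f y)
      <= betaC f M xbar * enorm (y - xbar);
  ar_strong_a : forall x sigma, eball xbar deltaA x ->
    0 < sigma <= deltaA ->
    let y := projset M x in
    forall g g', goldstein f sigma x g -> goldstein f sigma x g' ->
    [/\ enorm (projset (tangent M y) (g - cov_grad M f y))
          <= Ca * (dist_set x M + sigma),
        enorm (projset (tangent M y) g)
          <= Ca * (dist_set x M + sigma) + betaC f M xbar * enorm (y - xbar)
      & enorm (projset (tangent M y) (g - g'))
          <= 2 * Ca * (dist_set x M + sigma)];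
  ar_aiming : forall x, eball xbar deltaA x ->
    forall v, clarke f x v ->
    muC f M xbar * dist_set x M <= dotp v (x - projset M x);
  ar_bound : forall x sigma, eball xbar deltaA x ->
    0 < sigma <= deltaA ->
    forall g, goldstein f sigma x g -> enorm g <= LC f xbar;
  ar_upper : forall x, eball xbar deltaA x ->
    f x - f xbar <= LC f xbar * dist_set x M
      + betaC f M xbar / 2 * enorm (projset M x - xbar) ^+ 2
}.

Definition D1 f M xbar : R :=
  muC f M xbar / (8 * (muC f M xbar + LC f xbar)).

Definition C2 (gamma Ca deltaA : R) : R :=
  Num.min (gamma / (8 * Ca)) (Num.min 1 (1 / deltaA) / 2).

(* D_1 / C_M is read as +oo when C_M = 0, whereas D_1 / 0 = 0 in the library *)
Definition deltaGI f M xbar (deltaA : R) : R :=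
  if C_M M xbar == 0 then deltaA / 4
  else Num.min (deltaA / 4) (D1 f M xbar / C_M M xbar).

Definition normal_regime M xbar (a1 a2 : R) x (sigma : R) : Prop :=
  a1 / 2 * dist_set x M <= sigma <= a1 * dist_set x M /\
  a2 ^+ 2 * enorm (projset M x - xbar) ^+ 2 <= dist_set x M.

Definition tangent_regime M xbar (a2 : R) x (sigma : R) : Prop :=
  a2 / 2 * enorm (projset M x - xbar) <= sigma
    <= a2 * enorm (projset M x - xbar) /\
  dist_set x M / sigma <= 2 * a2 * enorm (projset M x - xbar).

End Nonsmooth.

(* Main.v *)
(* Write y for the projection of x, D for its distance to M and r = |y - xbar|.
   In the normal regime, the aiming inequality survives in the Goldstein
   subdifferential: <g, x - y> >= (mu / 2) D, so every g has norm at least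
   mu / 2, while f x - f xbar = O(D). In the tangent regime, strong (a)-regularity
   makes the tangential part of g close to the covariant gradient at y, whose norm
   is at least (gamma / 2) r, so g has norm at least (gamma / 4) r, while
   f x - f xbar = O(r^2). *)
Require Import Defs.
From mathcomp Require Import all_boot all_order all_algebra.
From mathcomp Require Import ring lra.
From mathcomp Require Import all_classical all_reals all_analysis.
Set Implicit Arguments.
Unset Strict Implicit.

Import Order.TTheory GRing.Theory Num.Theory.
Import numFieldNormedType.Exports.
Local Open Scope classical_set_scope.
Local Open Scope ring_scope.

(** * Euclidean inner product and norm *)

Section DotProduct.
Context {R : realType} {d : nat}.
Implicit Types (x y z : 'rV[R]_d).

Lemma dotpC x y : dotp x y = dotp y x.
Proof. by apply: eq_bigr => i _; rewrite mulrC. Qed.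

Lemma dotpDl x y z : dotp (x + y) z = dotp x z + dotp y z.
Proof. by rewrite -big_split; apply: eq_bigr => i _; rewrite mxE mulrDl. Qed.

Lemma dotpZl (a : R) x y : dotp (a *: x) y = a * dotp x y.
Proof. by rewrite mulr_sumr; apply: eq_bigr => i _; rewrite mxE mulrA. Qed.

Lemma dotpNl x y : dotp (- x) y = - dotp x y.
Proof. by rewrite -scaleN1r dotpZl mulN1r. Qed.

Lemma dotpBl x y z : dotp (x - y) z = dotp x z - dotp y z.
Proof. by rewrite dotpDl dotpNl. Qed.

Lemma dotpDr x y z : dotp x (y + z) = dotp x y + dotp x z.
Proof. by rewrite dotpC dotpDl !(dotpC _ x). Qed.

Lemma dotpBr x y z : dotp x (y - z) = dotp x y - dotp x z.
Proof. by rewrite dotpC dotpBl !(dotpC _ x). Qed.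

Lemma dotpZr (a : R) x y : dotp x (a *: y) = a * dotp x y.
Proof. by rewrite dotpC dotpZl dotpC. Qed.

Lemma dotp_suml n (g : 'I_n -> 'rV[R]_d) y :
  dotp (\sum_i g i) y = \sum_i dotp (g i) y.
Proof.
elim/big_ind2: _ => [|x a z b <- <-|//]; last by rewrite dotpDl.
by rewrite -[0]subr0 dotpBl subrr.
Qed.

Lemma dotp_mulmx x y : dotp x y = (x *m y^T) 0 0.
Proof. by rewrite mxE; apply: eq_bigr => i _; rewrite mxE. Qed.

Lemma dotp_ge0 x : 0 <= dotp x x.
Proof. by apply: sumr_ge0 => i _; rewrite -expr2 sqr_ge0. Qed.

Lemma dotp_eq0 x : dotp x x = 0 -> x = 0.
Proof.
move=> /eqP; rewrite psumr_eq0 => [/allP x0|i _]; last by rewrite -expr2 sqr_ge0.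
apply/rowP => i; rewrite mxE; apply/eqP.
by have := x0 i (mem_index_enum i); rewrite mulf_eq0 orbb.
Qed.

Lemma enorm_ge0 x : 0 <= enorm x.
Proof. exact: sqrtr_ge0. Qed.

Lemma enorm_sqr x : enorm x ^+ 2 = dotp x x.
Proof. by rewrite sqr_sqrtr // dotp_ge0. Qed.

Lemma enorm0 : enorm (0 : 'rV[R]_d) = 0.
Proof. by rewrite /enorm -(scale0r 0) dotpZl mul0r sqrtr0. Qed.

Lemma enorm_eq0 x : enorm x = 0 -> x = 0.
Proof. by move=> x0; apply: dotp_eq0; rewrite -enorm_sqr x0 expr0n. Qed.

Lemma enormN x : enorm (- x) = enorm x.
Proof. by rewrite /enorm dotpNl dotpC dotpNl opprK. Qed.

Lemma enorm_distC x y : enorm (x - y) = enorm (y - x).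
Proof. by rewrite -enormN opprB. Qed.

Lemma pythagoras x y : dotp x y = 0 ->
  enorm (x + y) ^+ 2 = enorm x ^+ 2 + enorm y ^+ 2.
Proof.
by move=> xy; rewrite !enorm_sqr dotpDl !dotpDr (dotpC y) xy addr0 add0r.
Qed.

Lemma cauchy_schwarz x y : dotp x y <= enorm x * enorm y.
Proof.
have [y0|y0] := eqVneq (dotp y y) 0.
  by rewrite (dotp_eq0 y0) enorm0 mulr0 dotpC -(scale0r 0) dotpZl mul0r.
have ygt0 : 0 < dotp y y by rewrite lt_neqAle eq_sym y0 dotp_ge0.
(* The squared norm of this vector is [|y|^2 (|x|^2 |y|^2 - <x,y>^2)]. *)
have := dotp_ge0 (dotp y y *: x - dotp x y *: y).
rewrite !(dotpBl, dotpBr, dotpZl, dotpZr) (dotpC y x) => h.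
have sq : dotp x y ^+ 2 <= (enorm x * enorm y) ^+ 2.
  rewrite exprMn !enorm_sqr -(ler_pM2l ygt0) -subr_ge0.
  by apply: le_trans h _; rewrite le_eqVlt; apply/orP; left; apply/eqP; ring.
apply: le_trans (ler_norm _) _.
by rewrite -(ger0_norm (mulr_ge0 (enorm_ge0 x) (enorm_ge0 y))) -ler_sqr
  ?nnegrE // !real_normK ?num_real.
Qed.

Lemma enorm_dotp_ge x y : - (enorm x * enorm y) <= dotp x y.
Proof. by rewrite lerNl -dotpNl -(enormN x) cauchy_schwarz. Qed.

Lemma enormD x y : enorm (x + y) <= enorm x + enorm y.
Proof.
rewrite -ler_sqr ?nnegrE ?addr_ge0 ?enorm_ge0 // sqrrD !enorm_sqr.
rewrite dotpDl !dotpDr (dotpC y x).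
have := cauchy_schwarz x y; lra.
Qed.

Lemma enorm_triangle y x z : enorm (x - z) <= enorm (x - y) + enorm (y - z).
Proof. by rewrite -[x - z](subrKA y) enormD. Qed.

End DotProduct.

(** * Projections onto tangent spaces, distances and convex hulls *)

Section Projections.
Context {R : realType} {d : nat}.
Implicit Types (x y u v w : 'rV[R]_d) (M : set 'rV[R]_d).

(** Normal equations: with the rows of [B] a basis of the kernel, the Gram matrix [B *m B^T] is
    invertible, because [v B B^T = 0] forces [|v B|^2 = 0]. *)
Lemma kernel_orthogonal_decomposition m (A : 'M[R]_(d, m)) u :
  exists2 p : 'rV[R]_d, p *m A = 0 &
    forall w, w *m A = 0 -> dotp (u - p) w = 0.
Proof.
have [r [B [Bfree BA Bspan]]] : exists r (B : 'M[R]_(r, d)),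
    [/\ row_free B, B *m A = 0
      & forall w : 'rV[R]_d, w *m A = 0 -> exists z, w = z *m B].
  exists (\rank (kermx A)), (row_base (kermx A)); split.
  - exact: row_base_free.
  - by apply/eqP; rewrite -sub_kermx eq_row_base.
  - move=> w /eqP; rewrite -sub_kermx -(eq_row_base (kermx A)) => /submxP[z ->].
    by exists z.
have unitG : B *m B^T \in unitmx.
  rewrite -row_free_unit; apply/inj_row_free => v vG0.
  have vB0 : v *m B = 0.
    apply: dotp_eq0.
    by rewrite dotp_mulmx trmx_mul mulmxA -(mulmxA v) vG0 mul0mx mxE.
  by apply: (row_free_inj Bfree); rewrite /= mul0mx.
exists (u *m B^T *m invmx (B *m B^T) *m B); first by rewrite -mulmxA BA mulmx0.
move=> w /Bspan[z ->].
rewrite dotp_mulmx trmx_mul mulmxA mulmxBl -!mulmxA mulVmx //.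
by rewrite mulmx1 subrr mul0mx mxE.
Qed.

(** By Pythagoras the orthogonal projection is the only nearest point of the kernel, so the choice
    in [projset] must return it. *)
Lemma projset_kernel m (A : 'M[R]_(d, m)) u :
  let p := projset [set v | v *m A = 0] u in
  p *m A = 0 /\ forall w, w *m A = 0 -> dotp (u - p) w = 0.
Proof.
have [p pA porth] := kernel_orthogonal_decomposition A u.
have pyth z : z *m A = 0 ->
    enorm (u - z) ^+ 2 = enorm (u - p) ^+ 2 + enorm (p - z) ^+ 2.
  move=> zA; rewrite -(subrKA p u); apply: pythagoras.
  by apply: porth; rewrite mulmxBl pA zA subrr.
suff -> : projset [set v | v *m A = 0] u = p by [].
apply: xget_unique => [|q [qA qmin]].
  split=> // z zA; rewrite -ler_sqr ?nnegrE ?enorm_ge0 // (pyth z) //.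
  by rewrite lerDl sqr_ge0.
have := qmin p pA; rewrite -ler_sqr ?nnegrE ?enorm_ge0 // (pyth q) // gerDl => pq.
apply/esym/eqP; rewrite -subr_eq0; apply/eqP/enorm_eq0/eqP.
by rewrite -sqrf_eq0 eq_le pq sqr_ge0.
Qed.

(** The default value of [tangent], the zero space, is the kernel of the identity matrix; the
    projection facts below thus hold at every point. *)
Lemma tangent_kernel M y :
  exists m (A : 'M[R]_(d, m)), tangent M y = [set v | v *m A = 0].
Proof.
rewrite /tangent; case: xgetP => [T _ [m [U [F [_ ->]]]]|_]; first by exists m, ('J F y).
exists d, 1%:M; rewrite eqEsubset; split=> v /=; first by move=> ->; rewrite mul0mx.
by rewrite mulmx1.
Qed.

Lemma tangent0 M y : tangent M y 0.
Proof. by have [m [A ->]] := tangent_kernel M y; rewrite /= mul0mx. Qed.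

Lemma projset_tangent M y u : tangent M y (projset (tangent M y) u).
Proof. by have [m [A ->]] := tangent_kernel M y; have [] := projset_kernel A u. Qed.

Lemma projset_tangent_orth M y u w : tangent M y w ->
  dotp (u - projset (tangent M y) u) w = 0.
Proof.
by have [m [A ->]] := tangent_kernel M y; have [_] := projset_kernel A u; apply.
Qed.

Lemma enorm_projset_tangent_compl M y u :
  enorm (u - projset (tangent M y) u) <= enorm u.
Proof.
rewrite -ler_sqr ?nnegrE ?enorm_ge0 //.
have orth := projset_tangent_orth u (projset_tangent M y u).
have := pythagoras orth; rewrite subrK => ->.
by rewrite lerDl sqr_ge0.
Qed.

Lemma cov_grad_tangent M f y : tangent M y (cov_grad M f y).
Proof.
rewrite /cov_grad; case: xgetP => [w _ [fhat [_ ->]]|_]; last exact: tangent0.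
exact: projset_tangent.
Qed.

(** Pairing with the tangent vector [w] sees only the tangential part [p] of [g - w]:
    [|w|^2 = <g,w> - <p,w>], and Cauchy-Schwarz lets one divide by [|w|]. *)
Lemma enorm_le_tangent_error M y w g : tangent M y w ->
  enorm w <= enorm g + enorm (projset (tangent M y) (g - w)).
Proof.
move=> Tw; set p := projset _ _.
have [->|w0] := eqVneq (enorm w) 0; first by rewrite addr_ge0 ?enorm_ge0.
have wgt0 : 0 < enorm w by rewrite lt_neqAle eq_sym w0 enorm_ge0.
rewrite -(ler_pM2r wgt0) -expr2 enorm_sqr mulrDl.
have : dotp (g - w - p) w = 0 by exact: projset_tangent_orth.
rewrite !dotpBl => o.
have := cauchy_schwarz g w; have := enorm_dotp_ge p w; lra.
Qed.

Lemma edist_nearest M x y : nearest M x y -> edist_set x M = (enorm (x - y))%:E.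
Proof.
move=> [My ymin]; apply/eqP; rewrite eq_le; apply/andP; split.
  by apply: ereal_inf_lbound; exists y.
by apply: le_ereal_inf_tmp => _ [z Mz <-]; rewrite lee_fin ymin.
Qed.

Lemma convhull_sub (X : set 'rV[R]_d) : X `<=` convhull X.
Proof.
move=> x Xx; exists 1%N, (fun=> 1), (fun=> x).
by split=> //; rewrite big_ord1 ?scale1r.
Qed.

(** Half-spaces are convex; this carries linear lower bounds from Clarke to Goldstein
    subgradients. *)
Lemma convhull_dotp_ge (X : set 'rV[R]_d) w (c : R) :
  (forall v, X v -> c <= dotp v w) -> forall g, convhull X g -> c <= dotp g w.
Proof.
move=> Xc _ [n [t [v [t0 t1 Xv ->]]]]; rewrite dotp_suml.
rewrite -[c]mul1r -t1 mulr_suml; apply: ler_sum => i _.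
by rewrite dotpZl ler_wpM2l // Xc.
Qed.

Lemma clarke_goldstein f x sigma z v :
  ecball x sigma z -> clarke f z v -> goldstein f sigma x v.
Proof. by move=> xz zv; apply: convhull_sub; exists z. Qed.

Lemma edist_ge0 x (X : set 'rV[R]_d) : (0 <= edist_set x X)%E.
Proof. by apply: le_ereal_inf_tmp => _ [z _ <-]; rewrite lee_fin enorm_ge0. Qed.

Lemma muC_ge0 (f : 'rV[R]_d -> R) M xbar : 0 <= muC f M xbar.
Proof.
rewrite mulr_ge0 ?invr_ge0 ?ler0n // fine_ge0 //.
rewrite /limf_einf /limf_esup /= oppe_ge0; apply: ge_ereal_inf.
(* The liminf is minus an infimum of suprema over the sets of the filter; the whole space is such a
   set, and its supremum is already nonpositive. *)
exists (ereal_sup [set (- edist_set 0 (clarke f x))%E | x in setT]).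
  by exists setT => //; exact: filterT.
by apply: ge_ereal_sup => _ [x _ <-]; rewrite oppe_le0 edist_ge0.
Qed.

(** Working in the extended reals also covers empty [X], at distance [+oo]. *)
Lemma le_mule_edist0 (X : set 'rV[R]_d) (c sigma : R) : 0 < sigma ->
  (forall g, X g -> c <= sigma * enorm g) ->
  (c%:E <= sigma%:E * edist_set 0 X)%E.
Proof.
move=> s0 Xc; rewrite -[c](mulrVK (unitf_gt0 s0)) mulrC EFinM.
apply: lee_wpmul2l; first by rewrite lee_fin ltW.
apply: le_ereal_inf_tmp => _ [g Xg <-].
by rewrite sub0r enormN lee_fin ler_pdivrMr // mulrC Xc.
Qed.

End Projections.

(* If m = 0, the quotient k / (c * m) is 0 in Rocq. *)
Lemma ler_ratio_mul {R : realType} (k c m t F : R) :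
  0 <= k -> 0 < c -> 0 <= m -> 0 <= t -> F <= m * t ->
  k / (c * m) * F <= k / c * t.
Proof.
move=> k0 c0 m0 t0 Fmt.
have [->|mN0] := eqVneq m 0.
  by rewrite mulr0 invr0 mulr0 mul0r !mulr_ge0 // invr_ge0 ltW.
apply: le_trans (ler_wpM2l _ Fmt) _.
  by rewrite mulr_ge0 // invr_ge0 mulr_ge0 // ltW.
rewrite le_eqVlt; apply/orP; left; apply/eqP; field.
by rewrite mN0 gt_eqF.
Qed.

(** * Lower bounds on Goldstein subgradients in the two regimes *)

Section GrowthInequality.
Context {R : realType} {d : nat} {f : 'rV[R]_d -> R} {xbar : 'rV[R]_d}
  {M : set 'rV[R]_d} {gamma Ca deltaA : R}
  (hf : typical f xbar M gamma Ca)
  (hdelta : admissible_radius f xbar M gamma Ca deltaA).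
Implicit Types (x y z v g : 'rV[R]_d).

Local Notation mu := (muC f M xbar).
Local Notation L := (LC f xbar).
Local Notation beta := (betaC f M xbar).
Local Notation P := (projset M).

Let dA_gt0 : 0 < deltaA := ar_gt0 hdelta.

Lemma typical_mem : M xbar.
Proof. by case: (typical_active hf). Qed.

Lemma eball_le x (r s : R) : r <= s -> eball xbar r x -> eball xbar s x.
Proof. by move=> rs xr; apply: lt_le_trans rs. Qed.

Lemma eball_double x : eball xbar deltaA x -> eball xbar (2 * deltaA) x.
Proof. by apply: eball_le; have := dA_gt0; lra. Qed.

Lemma nearest_projset x : eball xbar deltaA x -> nearest M x (P x).
Proof.
move=> /eball_double /(ar_proj hdelta)[y [xy _]].
by apply: xgetPex; exists y.
Qed.

Lemma dist_setE x : eball xbar deltaA x -> dist_set x M = enorm (x - P x).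
Proof. by move=> /nearest_projset /edist_nearest; rewrite /dist_set => ->. Qed.

Lemma dist_set_le x z : eball xbar deltaA x -> M z ->
  dist_set x M <= enorm (x - z).
Proof.
by move=> xA Mz; rewrite dist_setE //; have [_] := nearest_projset xA; apply.
Qed.

Lemma deltaGI_le : deltaGI f M xbar deltaA <= deltaA / 4.
Proof. by rewrite /deltaGI; case: ifP => // _; rewrite ge_min lexx. Qed.

Lemma eballGI x : eball xbar (deltaGI f M xbar deltaA) x ->
  enorm (x - xbar) < deltaA / 4 /\ eball xbar deltaA x.
Proof.
move=> /(eball_le deltaGI_le) xA; split=> //.
by apply: eball_le xA; have := dA_gt0; lra.
Qed.

Lemma clarke_bound x v : eball xbar deltaA x -> clarke f x v -> enorm v <= L.
Proof.
move=> xA xv; apply: (ar_bound hdelta xA (sigma := deltaA)).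
  by rewrite dA_gt0 lexx.
apply: clarke_goldstein xv.
by rewrite /ecball /= subrr enorm0 ltW.
Qed.

(** The subgradient bound is applied to [0], which lies in [clarke f xbar]. *)
Lemma LC_ge0 : 0 <= L.
Proof.
rewrite -(enorm0 (R := R) (d := d)); apply: (clarke_bound (x := xbar)).
  by rewrite /eball /= subrr enorm0.
by case: (typical_active hf).
Qed.

(** Since [mu] is the numerator of [D1], a nonempty range for [a1] excludes the degenerate value
    [mu = 0]. *)
Lemma muC_gt0 : 0 < D1 f M xbar -> 0 < mu.
Proof.
move=> D10; rewrite lt_neqAle eq_sym muC_ge0 andbT.
by apply/eqP => mu0; move: D10; rewrite /D1 mu0 mul0r ltxx.
Qed.

Lemma D1_mul : 0 < D1 f M xbar -> (mu + L) * D1 f M xbar = mu / 8.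
Proof.
move=> /muC_gt0 mu0; rewrite /D1; field.
by rewrite gt_eqF // ltr_pwDl // LC_ge0.
Qed.

(** This is what the bound [D1 / C_M] in [deltaGI] provides, as [dist_set x M <= enorm (x - xbar)].
    For [C_M <= 0] the left side is nonpositive. *)
Lemma C_M_dist_le x : 0 < D1 f M xbar ->
  eball xbar (deltaGI f M xbar deltaA) x ->
  C_M M xbar * dist_set x M <= D1 f M xbar.
Proof.
move=> D10 xGI; have [_ xA] := eballGI xGI.
have Dge0 : 0 <= dist_set x M by rewrite dist_setE // enorm_ge0.
have [C0|C0] := leP (C_M M xbar) 0.
  by apply: le_trans (ltW D10); rewrite mulr_le0_ge0.
have := dist_set_le xA typical_mem; move: xGI.
rewrite /eball /deltaGI /= gt_eqF // lt_min => /andP[_ xD] Dx.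
by rewrite mulrC -ler_pdivlMr //; apply: le_trans Dx (ltW xD).
Qed.

Lemma projset_residual_lipschitz x z : eball xbar deltaA x ->
  eball xbar (2 * deltaA) z ->
  enorm (x - P x - (z - P z)) <=
    enorm (x - z) + C_M M xbar * (dist_set x M ^+ 2 + enorm (x - z) ^+ 2).
Proof.
move=> xA zA; set T := tangent M (P x).
(* Minus the normal component of [z - x], plus the first-order Taylor error of [P]. *)
have -> : x - P x - (z - P z) =
    - (z - x - projset T (z - x)) + (P z - P x - projset T (z - x)).
  by apply/rowP => i; rewrite !mxE; ring.
apply: le_trans (enormD _ _) _; apply: lerD.
  by rewrite enormN (enorm_distC x z) enorm_projset_tangent_compl.
exact: (ar_proj_taylor hdelta).
Qed.

(* The aiming inequality at the points z of the sigma-ball is transported to x: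
   x - P x and z - P z differ by O(sigma + dist^2), since the projection onto
   the normal space is nonexpansive and P is tangential to first order. *)
Lemma goldstein_normal_bound x (sigma : R) g : 0 < D1 f M xbar ->
  eball xbar (deltaGI f M xbar deltaA) x -> 0 < dist_set x M ->
  sigma <= D1 f M xbar * dist_set x M -> goldstein f sigma x g ->
  mu / 2 <= enorm g.
Proof.
move=> D10 xGI D0 sD gx; have [x4 xA] := eballGI xGI.
have mu0 := muC_gt0 D10; have L0 := LC_ge0; have D1E := D1_mul D10.
set D := dist_set x M in D0 sD *; set t := D1 f M xbar in D10 sD D1E.
have t8 : t <= 8^-1.
  by rewrite -(ler_pM2l (ltr_pwDl mu0 L0)) D1E; lra.
have sD8 : sigma <= D / 8.
  by apply: le_trans sD _; rewrite mulrC ler_pM2l.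
have DA : D < deltaA / 4 by apply: le_lt_trans x4; exact: dist_set_le typical_mem.
(* Enough by Cauchy-Schwarz, as [|x - P x| = D > 0]. Being linear in [g], the inequality need only
   be checked on Clarke subgradients [v] at points [z] of the ball. *)
suff : mu / 2 * D <= dotp g (x - P x).
  have := cauchy_schwarz g (x - P x); rewrite -dist_setE // -/D => h1 h2.
  by rewrite -(ler_pM2r D0); apply: le_trans h2 h1.
apply: convhull_dotp_ge gx => v [z]; rewrite /ecball /= => xz zv.
have zA : eball xbar deltaA z.
  rewrite /eball /=; apply: le_lt_trans (enorm_triangle x _ _) _.
  by have := dA_gt0; lra.
have aim := ar_aiming hdelta zA zv.
have dz : D - sigma <= dist_set z M.
  have [Mz _] := nearest_projset zA.
  rewrite (dist_setE zA); have := dist_set_le xA Mz.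
  have := enorm_triangle z x (P z); rewrite (enorm_distC x z) -/D; lra.
have vL := clarke_bound zA zv.
set e := x - P x - (z - P z).
(* From [|z - x| <= sigma <= D] and [C_M D <= t], the Taylor error is at most
   [2 C_M D^2 <= 2 t D]. *)
have eE : enorm e <= sigma + 2 * t * D.
  apply: le_trans (projset_residual_lipschitz xA (eball_double zA)) _.
  rewrite (enorm_distC x z) -/D.
  have CD : C_M M xbar * D <= t := C_M_dist_le D10 xGI.
  apply: lerD => //.
  have [C0|C0] := leP (C_M M xbar) 0.
    apply: (@le_trans _ _ 0); first by rewrite mulr_le0_ge0 // addr_ge0 ?sqr_ge0.
    by rewrite mulr_ge0 ?(ltW D0) // mulr_ge0 // ltW.
  have zx2 : enorm (z - x) ^+ 2 <= D ^+ 2.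
    by rewrite ler_sqr ?nnegrE ?enorm_ge0 //; lra.
  have : C_M M xbar * (D ^+ 2 + enorm (z - x) ^+ 2) <= C_M M xbar * (2 * D ^+ 2).
    by rewrite ler_pM2l //; lra.
  have : C_M M xbar * D * D <= t * D by rewrite ler_pM2r.
  by lra.
have -> : x - P x = (z - P z) + e by rewrite [RHS]addrC subrK.
rewrite dotpDr.
have ve : - (L * (sigma + 2 * t * D)) <= dotp v e.
  apply: le_trans (enorm_dotp_ge v e); rewrite lerN2.
  by apply: ler_pM; rewrite ?enorm_ge0.
(* Budget: of [mu D], the term [(mu + L) sigma] costs at most [mu D / 8] and [2 L t D] at most
   [mu D / 4], leaving [5 mu D / 8]. *)
have h1 : mu * (D - sigma) <= mu * dist_set z M by rewrite ler_pM2l.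
have h2 : (mu + L) * sigma <= (mu + L) * (t * D) by rewrite ler_pM2l // ltr_pwDl.
have h3 : L * (t * D) <= mu / 8 * D.
  rewrite mulrA ler_pM2r // -D1E ler_pM2r //; lra.
have muD : 0 <= mu * D by rewrite mulr_ge0 // ltW.
move: h2; rewrite mulrA D1E; lra.
Qed.

(** The second entry of [C2] forces [a r <= 1/4], hence [D <= sigma / 2]; the first then keeps the
    regularity error [Ca (D + sigma)] below [3 gamma r / 16], leaving [5 gamma r / 16] out of
    [gamma r / 2]. *)
Lemma goldstein_tangent_bound x (a sigma : R) g :
  0 < a <= C2 gamma Ca deltaA ->
  eball xbar (deltaGI f M xbar deltaA) x -> 0 < sigma ->
  sigma <= a * enorm (P x - xbar) ->
  dist_set x M <= 2 * a * enorm (P x - xbar) * sigma ->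
  goldstein f sigma x g -> gamma / 4 * enorm (P x - xbar) <= enorm g.
Proof.
move=> /andP[a0 aC] xGI s0 sr Ds gx; have [x4 xA] := eballGI xGI.
have Ca0 := typical_Ca_gt0 hf; have g0 := typical_gamma_gt0 hf.
set r := enorm (P x - xbar) in sr Ds *.
have r0 : 0 < r by rewrite -(pmulr_rgt0 _ a0); apply: lt_le_trans s0 sr.
(* Projecting at most doubles the distance to [xbar], since [|x - P x| <= |x - xbar|]. *)
have rA : r <= deltaA / 2.
  have := enorm_triangle x (P x) xbar; rewrite -/r (enorm_distC (P x)).
  rewrite -dist_setE //; have := dist_set_le xA typical_mem; lra.
move: aC; rewrite /C2 le_min ler_pdivlMr ?mulr_gt0 // => /andP[aCa aA].
have a2 : a <= 2^-1.
  by apply: le_trans aA _; rewrite ler_pdivrMr // mulVf // ge_min lexx.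
have adA : a * deltaA <= 2^-1.
  rewrite -ler_pdivlMr //; apply: le_trans aA _.
  by rewrite mulrC ler_pM2l // ge_min div1r lexx orbT.
have ar4 : a * r <= 4^-1.
  have : a * r <= a * (deltaA / 2) by rewrite ler_pM2l.
  by move: adA; lra.
have sA : 0 < sigma <= deltaA.
  rewrite s0 (le_trans sr) //.
  have : a * r <= 2^-1 * r by rewrite ler_pM2r.
  by have := dA_gt0; lra.
have [err _ _] := ar_strong_a hdelta xA sA gx gx.
have /andP[lower _] := ar_cov_grad hdelta xA.
have tri := enorm_le_tangent_error g (cov_grad_tangent M f (P x)).
have DsE : dist_set x M <= 2^-1 * sigma.
  by apply: le_trans Ds _; rewrite ler_pM2r //; lra.
have h1 : Ca * (dist_set x M + sigma) <= Ca * (3 / 2 * (a * r)).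
  by rewrite ler_pM2l //; lra.
have h2 : a * (8 * Ca) * r <= gamma * r by rewrite ler_pM2r.
have gr : 0 < gamma * r by rewrite mulr_gt0.
move: err lower tri h1 h2 gr; rewrite -/r; lra.
Qed.

End GrowthInequality.

(** * The growth inequality and the choice of [sigma] *)

Theorem theorem4p3 (R : realType) (d : nat) (f : 'rV[R]_d -> R)
  (xbar : 'rV[R]_d) (M : set 'rV[R]_d) (gamma Ca deltaA : R)
  (hf : typical f xbar M gamma Ca)
  (hdelta : admissible_radius f xbar M gamma Ca deltaA)
  (a1 a2 : R)
  (ha1 : 0 < a1 <= D1 f M xbar)
  (ha2 : 0 < a2 <= C2 gamma Ca deltaA) :
  let mu := muC f M xbar in
  let L := LC f xbar in
  let beta := betaC f M xbar in
  (forall (x : 'rV[R]_d) (sigma : R),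
     eball xbar (deltaGI f M xbar deltaA) x -> 0 < sigma ->
     normal_regime M xbar a1 a2 x sigma \/ tangent_regime M xbar a2 x sigma ->
     ((Num.min (gamma * a2 / (8 * Num.max (4 * L * a2 ^+ 2) beta))
               (mu * a1 / (4 * Num.max (2 * L) (beta / a2 ^+ 2)))
       * (f x - f xbar))%:E
      <= sigma%:E * edist_set (0%R : 'rV[R]_d) (goldstein f sigma x))%E)
  /\
  (forall x : 'rV[R]_d,
     eball xbar (deltaGI f M xbar deltaA) x -> x <> xbar ->
     exists2 sigma : R, 0 < sigma &
       normal_regime M xbar a1 a2 x sigma \/ tangent_regime M xbar a2 x sigma).
Proof.
move=> mu L beta.
have /andP[a1_gt0 a1D] := ha1; have /andP[a2_gt0 _] := ha2.
have D10 : 0 < D1 f M xbar := lt_le_trans a1_gt0 a1D.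
have mu0 : 0 < mu := muC_gt0 D10.
have L0 : 0 <= L := LC_ge0 hf hdelta.
have dA0 := ar_gt0 hdelta; have gamma0 := typical_gamma_gt0 hf.
have a22 : 0 < a2 ^+ 2 by rewrite exprn_gt0.
split=> [x sigma xGI s0 regime|x xGI xN].
  have [x4 xA] := eballGI hdelta xGI.
  (* This sign allows the minimum to be replaced by whichever entry suits the regime. *)
  have F0 : 0 <= f x - f xbar.
    apply: le_trans (ar_growth hdelta _).
      by rewrite mulr_ge0 ?sqr_ge0 // divr_ge0 // ltW.
    by rewrite /ecball /=; lra.
  have := ar_upper hdelta xA; rewrite -/L -/beta => upper.
  apply: le_mule_edist0 => // g gx.
  set D := dist_set x M in upper; set r := enorm (projset M x - xbar) in upper.
  have r0 : 0 <= r := enorm_ge0 _.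
  case: regime => [[/andP[sl su] Dr]|[/andP[sl su] Ds]].
    have D0 : 0 < D by rewrite -(pmulr_rgt0 _ a1_gt0); apply: lt_le_trans s0 su.
    apply: le_trans (ler_wpM2r F0
      (_ : _ <= mu * a1 / (4 * Num.max (2 * L) (beta / a2 ^+ 2)))) _.
      by rewrite ge_min lexx orbT.
    set m := Num.max _ _.
    have [mL mb] : 2 * L <= m /\ beta / a2 ^+ 2 <= m.
      by rewrite !le_max !lexx orbT.
    have m0 : 0 <= m by apply: le_trans mL; rewrite mulr_ge0.
    (* Each term of the upper bound is at most [m D / 2]: the first by [2 L <= m], the second by
       [beta <= m a2^2] and [a2^2 r^2 <= D]. *)
    have FmD : f x - f xbar <= m * D.
      apply: le_trans upper _.
      have h1 : 2 * L * D <= m * D by rewrite ler_pM2r.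
      have h2 : m * (a2 ^+ 2 * r ^+ 2) <= m * D by rewrite ler_wpM2l.
      have h3 : beta * r ^+ 2 <= m * a2 ^+ 2 * r ^+ 2.
        by rewrite ler_wpM2r ?sqr_ge0 // -ler_pdivrMr.
      by move: h2; rewrite mulrA; lra.
    apply: le_trans (ler_ratio_mul _ _ m0 (ltW D0) FmD) _ => //.
      by rewrite mulr_ge0 // ltW.
    have gmu : mu / 2 <= enorm g.
      apply: (goldstein_normal_bound hf hdelta D10 xGI D0 _ gx).
      by apply: le_trans su _; rewrite ler_pM2r.
    (* Lower bound for [sigma] times lower bound for [|g|]. *)
    have -> : mu * a1 / 4 * D = a1 / 2 * D * (mu / 2) by field.
    by apply: ler_pM => //; [rewrite mulr_ge0 ?divr_ge0 // ltW | lra].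
  have rgt0 : 0 < r by rewrite -(pmulr_rgt0 _ a2_gt0); apply: lt_le_trans s0 su.
  move: Ds; rewrite ler_pdivrMr // -/D -/r => Ds.
  apply: le_trans (ler_wpM2r F0
    (_ : _ <= gamma * a2 / (8 * Num.max (4 * L * a2 ^+ 2) beta))) _.
    by rewrite ge_min lexx.
  set m := Num.max _ _.
  have [mL mb] : 4 * L * a2 ^+ 2 <= m /\ beta <= m.
    by rewrite !le_max !lexx orbT.
  have m0 : 0 <= m by apply: le_trans mL; rewrite mulr_ge0 ?sqr_ge0 // mulr_ge0.
  (* Here [D <= 2 a2 r sigma <= 2 a2^2 r^2], so each term of the upper bound is at most
     [m r^2 / 2]. *)
  have Fmr : f x - f xbar <= m * r ^+ 2.
    apply: le_trans upper _.
    have h1 : L * D <= L * (2 * a2 * r * (a2 * r)).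
      rewrite ler_wpM2l //; apply: le_trans Ds _.
      by rewrite ler_pM2l // !mulr_gt0.
    have h2 : 4 * L * a2 ^+ 2 * r ^+ 2 <= m * r ^+ 2 by rewrite ler_wpM2r ?sqr_ge0.
    have h3 : beta * r ^+ 2 <= m * r ^+ 2 by rewrite ler_wpM2r ?sqr_ge0.
    by lra.
  apply: le_trans (ler_ratio_mul _ _ m0 (sqr_ge0 r) Fmr) _ => //.
    by rewrite mulr_ge0 // ltW.
  have gr : gamma / 4 * r <= enorm g.
    exact: (goldstein_tangent_bound hf hdelta ha2 xGI s0 su Ds gx).
  have -> : gamma * a2 / 8 * r ^+ 2 = a2 / 2 * r * (gamma / 4 * r) by field.
  by apply: ler_pM => //; rewrite !mulr_ge0 // ltW.
have [x4 xA] := eballGI hdelta xGI.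
rewrite /normal_regime /tangent_regime.
have DE := dist_setE hdelta xA.
set D := dist_set x M in DE *; set r := enorm (projset M x - xbar).
have r0 : 0 <= r := enorm_ge0 _.
have D0 : 0 <= D by rewrite DE enorm_ge0.
(* Condition (b) of the normal regime decides; [sigma] is the upper end of the interval in (a).
   Positivity holds in the first case because [D = 0] would force [r = 0] and [x = xbar], in the
   second because [r = 0] would force [D < 0]. *)
have [Dr|Dr] := leP (a2 ^+ 2 * r ^+ 2) D.
  have Dgt0 : 0 < D.
    rewrite lt_neqAle D0 andbT; apply/eqP => D00; apply: xN.
    have xP : x - projset M x = 0 by apply: enorm_eq0; rewrite -DE.
    apply/eqP; rewrite -subr_eq0; apply/eqP/enorm_eq0.
    rewrite (subr0_eq xP) -/r; apply/eqP; rewrite -sqrf_eq0 eq_le sqr_ge0 andbT.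
    by rewrite -(ler_pM2l a22) mulr0 D00.
  exists (a1 * D); first by rewrite mulr_gt0.
  by left; split=> //; rewrite lexx andbT ler_pM2r // ; lra.
have rgt0 : 0 < r.
  rewrite lt_neqAle r0 andbT; apply/eqP => r00.
  by move: Dr; rewrite -r00 expr0n mulr0 ltNge D0.
exists (a2 * r); first by rewrite mulr_gt0.
right; split; first by rewrite lexx andbT ler_pM2r //; lra.
rewrite ler_pdivrMr ?mulr_gt0 //; apply: le_trans (ltW Dr) _.
rewrite -exprMn expr2 ler_pM2r ?mulr_gt0 // ler_pM2r //; lra.
Qed.
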